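(* Let $\mathfrak{h}(\lambda,\mu,\varphi,\operatorname{ad}_{\mathfrak{h}}^{\ast})$ be a Lie algebra on $\mathfrak{h}\oplus\mathfrak{a}\oplus\mathfrak{h}^{\ast}$ as described in the context, such that $\mu(x,y)(z)=\mu(y,z)(x)$ for all $x,y,z\in\mathfrak{h}$. Let $B_{\mathfrak{a}}$ be a symmetric and non-degenerate bilinear form on $\mathfrak{a}$ and let $\lambda_{\varphi}:\mathfrak{h}\times\mathfrak{h}\to\mathfrak{a}$ be the bilinear map determined by $\varphi(x)(u)(y)=-B_{\mathfrak{a}}(\lambda_{\varphi}(x,y),u)$ for all $x,y\in\mathfrak{h}$, $u\in\mathfrak{a}$. If there exists a linear map $L:\mathfrak{h}\to\mathfrak{a}$ such that (i) $\lambda_{\varphi}=\lambda+\mathrm{d}_{\mathfrak{a}}(L)$, and (ii) $B_{\mathfrak{a}}(\lambda_{\varphi}(y,z),L(x))=B_{\mathfrak{a}}(\lambda_{\varphi}(x,y),L(z))$ for all $x,y,z\in\mathfrak{h}$, then $\mathfrak{h}(\lambda,\mu,\varphi,\operatorname{ad}_{\mathfrak{h}}^{\ast})$ admits an invariant metric.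
   Context: All algebras and vector spaces are finite dimensional over a field $\mathbb{F}$ of characteristic zero. An invariant metric on a Lie algebra $\mathfrak{g}$ is a non-degenerate symmetric bilinear form $B$ with $B([x,y],z)=-B(y,[x,z])$ for all $x,y,z\in\mathfrak{g}$. The Lie algebra $\mathfrak{h}(\lambda,\mu,\varphi,\operatorname{ad}_{\mathfrak{h}}^{\ast})$: the data are a Lie algebra $(\mathfrak{h},[\cdot,\cdot]_{\mathfrak{h}})$ with coadjoint representation $\operatorname{ad}_{\mathfrak{h}}^{\ast}(x)(\alpha)=-\alpha\circ\operatorname{ad}_{\mathfrak{h}}(x)$ on $\mathfrak{h}^{\ast}$; a vector space $\mathfrak{a}$ (trivial $\mathfrak{h}$-module); a linear map $\varphi:\mathfrak{h}\to\operatorname{Hom}(\mathfrak{a},\mathfrak{h}^{\ast})$ with $\varphi([x,y]_{\mathfrak{h}})=\operatorname{ad}_{\mathfrak{h}}^{\ast}(x)\circ\varphi(y)-\operatorname{ad}_{\mathfrak{h}}^{\ast}(y)\circ\varphi(x)$; and skew-symmetric bilinear maps $\lambda:\mathfrak{h}\times\mathfrak{h}\to\mathfrak{a}$, $\mu:\mathfrak{h}\times\mathfrak{h}\to\mathfrak{h}^{\ast}$ satisfying $\mathrm{d}_{\mathfrak{a}}(\lambda)=0$ and $e_\varphi(\lambda)+\mathrm{d}_{\operatorname{ad}_{\mathfrak{h}}^{\ast}}(\mu)=0$. Here $\mathrm{d}_{\mathfrak{a}}$, $\mathrm{d}_{\operatorname{ad}_{\mathfrak{h}}^{\ast}}$ are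 the Chevalley–Eilenberg differentials of $\mathfrak{h}$ with values in the trivial module $\mathfrak{a}$ and in the coadjoint module $\mathfrak{h}^{\ast}$; $e_\varphi(\lambda)(x,y,z)=\varphi(x)(\lambda(y,z))+\varphi(y)(\lambda(z,x))+\varphi(z)(\lambda(x,y))$. The Lie bracket on $\mathfrak{h}\oplus\mathfrak{a}\oplus\mathfrak{h}^{\ast}$ is the skew-symmetric bilinear map with $[x,y]=[x,y]_{\mathfrak{h}}+\lambda(x,y)+\mu(x,y)$, $[x,u+\alpha]=\varphi(x)(u)+\operatorname{ad}_{\mathfrak{h}}^{\ast}(x)(\alpha)$, $[u+\alpha,v+\beta]=0$. For a linear map $L:\mathfrak{h}\to\mathfrak{a}$: $\mathrm{d}_{\mathfrak{a}}(L)(x,y)=-L([x,y]_{\mathfrak{h}})$. *)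

(* Defs.v *)
From HB Require Import structures.
From mathcomp Require Import all_boot all_order all_algebra.
From mathcomp Require Import ring.

Set Implicit Arguments.
Unset Strict Implicit.
Unset Printing Implicit Defensive.

Import GRing.Theory.
Local Open Scope ring_scope.

HB.mixin Record isLieAlgebra (F : fieldType) V of Vector F V := {
  lie : V -> V -> V;
  lie_linearl : forall y, linear (lie^~ y);
  lie_linearr : forall x, linear (lie x);
  lie_alternating : forall x, lie x x = 0;
  lie_jacobi : forall x y z,
    lie x (lie y z) + lie y (lie z x) + lie z (lie x y) = 0
}.

#[short(type="lieAlgType")]
HB.structure Definition LieAlgebra (F : fieldType) :=
  {V of Vector F V & isLieAlgebra F V}.

Section LieTheory.
Variables (F : fieldType) (g : lieAlgType F).

HB.instance Definition _ :=
  bilinear_isBilinear.Build F g g g *:%R *:%R (@lie F g)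
    (@lie_linearl F g, @lie_linearr F g).

HB.instance Definition _ (x : g) :=
  GRing.isLinear.Build F g g *:%R (lie x) (lie_linearr x).

Lemma lieC (x y : g) : lie x y = - lie y x.
Proof.
apply/eqP; rewrite -addr_eq0; apply/eqP.
have := lie_alternating (x + y).
by rewrite linearDl !linearDr /= !lie_alternating add0r addr0.
Qed.

Lemma lie_lie (x y z : g) : lie (lie x y) z = lie x (lie y z) - lie y (lie x z).
Proof.
rewrite (lieC (lie x y)) (lieC x z) linearNr opprK.
by apply/esym/eqP; rewrite -subr_eq0 opprK lie_jacobi.
Qed.

End LieTheory.

Definition skew_symmetric_map (F : fieldType) (U V : vectType F)
    (f : U -> U -> V) : Prop :=
  forall x y, f x y = - f y x.

Definition invariant_metric (F : fieldType) (g : lieAlgType F)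
    (B : {symmetric g}) : Prop :=
  nondegenerate B /\ forall x y z : g, B (lie x y) z = - B y (lie x z).

Definition admits_invariant_metric (F : fieldType) (g : lieAlgType F) : Prop :=
  exists B : {symmetric g}, invariant_metric B.

Section Cochains.
Variables (F : fieldType) (h : lieAlgType F).

Definition ad (x : h) : 'End(h) := linfun (lie x).

Definition coad (x : h) (alpha : 'Hom(h, F^o)) : 'Hom(h, F^o) :=
  - (alpha \o ad x)%VF.

Definition trivial_action (V : vectType F) (x : h) (v : V) : V := 0.

Variables (V : vectType F) (rho : h -> V -> V).

Definition ce_d1 (f : h -> V) (x y : h) : V :=
  rho x (f y) - rho y (f x) - f (lie x y).

Definition ce_d2 (f : h -> h -> V) (x y z : h) : V :=
  rho x (f y z) - rho y (f x z) + rho z (f x y)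
  - f (lie x y) z + f (lie x z) y - f (lie y z) x.

Lemma coadE x (alpha : 'Hom(h, F^o)) z : coad x alpha z = - alpha (lie x z).
Proof. by rewrite /coad opp_lfunE comp_lfunE lfunE. Qed.

Lemma coad_linearl alpha c x y :
  coad (c *: x + y) alpha = c *: coad x alpha + coad y alpha.
Proof.
apply/lfunP=> z; rewrite add_lfunE scale_lfunE !coadE linearPl linearP.
by rewrite opprD -scalerN.
Qed.

Lemma coad_linearr x : linear (coad x).
Proof.
move=> c alpha beta; apply/lfunP=> z; rewrite add_lfunE scale_lfunE !coadE.
by rewrite add_lfunE scale_lfunE opprD -scalerN.
Qed.

HB.instance Definition _ x :=
  GRing.isLinear.Build F 'Hom(h, F^o) 'Hom(h, F^o) *:%R (coad x) (coad_linearr x).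

Lemma coadD x : {morph coad x : alpha beta / alpha + beta}.
Proof. exact: linearD. Qed.

Lemma coadN x : {morph coad x : alpha / - alpha}.
Proof. exact: linearN. Qed.

Lemma coad_lie x y alpha :
  coad (lie x y) alpha = coad x (coad y alpha) - coad y (coad x alpha).
Proof.
apply/lfunP=> z; rewrite coadE add_lfunE (opp_lfunE (coad y _)) !coadE lie_lie linearB.
by rewrite opprB !opprK addrC.
Qed.

End Cochains.

Arguments trivial_action {F h} V x v.

Section Extension.
Variables (F : fieldType) (h : lieAlgType F) (a : vectType F).
Variables (lam : {bilinear h -> h -> a}) (mu : {bilinear h -> h -> 'Hom(h, F^o)}).
Variable phi : 'Hom(h, 'Hom(a, 'Hom(h, F^o))).

Definition e_phi (x y z : h) : 'Hom(h, F^o) :=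
  phi x (lam y z) + phi y (lam z x) + phi z (lam x y).

Record extension_data : Prop := ExtensionData {
  ext_phi : forall x y u,
    phi (lie x y) u = coad x (phi y u) - coad y (phi x u);
  ext_lam_skew : skew_symmetric_map lam;
  ext_mu_skew : skew_symmetric_map mu;
  ext_lam_closed : forall x y z, ce_d2 (trivial_action a) lam x y z = 0;
  ext_mu_closed : forall x y z, e_phi x y z + ce_d2 (@coad F h) mu x y z = 0
}.

(* ((x, u), alpha) stands for x + u + alpha; the two parenthesized terms are
   [x, v + beta] and [y, u + alpha]. *)
Definition ext_bracket (p q : h * a * 'Hom(h, F^o)) : h * a * 'Hom(h, F^o) :=
  let: (x, u, alpha) := p in let: (y, v, beta) := q in
  (lie x y, lam x y,
   mu x y + (phi x v + coad x beta) - (phi y u + coad y alpha)).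

(* The arguments [charF0] and [E] do not occur in the carrier: they are there
   for the Lie algebra instance below, where characteristic zero turns
   skew-symmetry of [lam] and [mu] into [lie x x = 0]. *)
Definition lie_ext (charF0 : [pchar F] =i pred0) (E : extension_data) : Type :=
  (h * a * 'Hom(h, F^o))%type.

Variables (charF0 : [pchar F] =i pred0) (E : extension_data).

HB.instance Definition _ :=
  Vector.copy (lie_ext charF0 E) (h * a * 'Hom(h, F^o))%type.

Lemma skew_alternating (V : vectType F) (f : h -> h -> V) :
  skew_symmetric_map f -> forall x, f x x = 0.
Proof.
move=> skewf x; have /eqP := skewf x x.
rewrite -addr_eq0 -mulr2n -scaler_nat scaler_eq0 => /orP[|/eqP//].
by have := charF0 2; rewrite !inE /= => ->.
Qed.

Lemma ext_linear_aux (V : lmodType F) (c : F) (m p r q s m' p' r' q' s' : V) :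
  c *: m + m' + (c *: p + p' + (c *: r + r')) - (c *: q + q' + (c *: s + s'))
  = c *: (m + (p + r) - (q + s)) + (m' + (p' + r') - (q' + s')).
Proof.
rewrite (addrACA (c *: p)) (addrACA (c *: q)) (addrACA (c *: m)) opprD [LHS]addrACA.
by rewrite -!scalerDr -scalerBr.
Qed.

Lemma ext_linearl q : linear (ext_bracket^~ q : lie_ext charF0 E -> lie_ext charF0 E).
Proof.
move: q => [[y v] beta] c [[x u] alpha] [[x' u'] alpha'].
congr (_, _, _) => /=; [exact: linearPl | exact: linearPl |].
rewrite linearPl coad_linearl coad_linearr !(linearP phi) (linearP (phi y)).
by rewrite add_lfunE scale_lfunE ext_linear_aux.
Qed.

Lemma ext_linearr p : linear (ext_bracket p : lie_ext charF0 E -> lie_ext charF0 E).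
Proof.
move: p => [[x u] alpha] c [[y v] beta] [[y' v'] beta'].
congr (_, _, _) => /=; [exact: linearPr | exact: linearPr |].
rewrite linearPr coad_linearl coad_linearr !(linearP phi) (linearP (phi x)).
by rewrite add_lfunE scale_lfunE ext_linear_aux.
Qed.

Lemma ext_alternating p : ext_bracket p p = 0.
Proof.
move: p => [[x u] alpha] /=.
rewrite lie_alternating (skew_alternating (ext_lam_skew E)).
by rewrite (skew_alternating (ext_mu_skew E)) add0r subrr.
Qed.

Lemma ext_jacobi_aux (fx fy fz mx my mz lx ly lz p p' q q' r r' s s' k k' n n' :
    'Hom(h, F^o)) :
  fx + fy + fz + (mx + my + mz - lz - ly - lx) = 0 ->
  - lx + (fx + (mx + (p + p') - (q + q'))) - (r - s + (r' - s'))
  + (- ly + (fy + (my + (r + r') - (k + k'))) - (n - q + (n' - q')))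
  + (- lz + (fz + (mz + (n + n') - (s + s'))) - (p - k + (p' - k'))) = 0.
Proof.
move=> /lfunP cocycle; apply/lfunP=> w; rewrite -{}cocycle.
rewrite !(add_lfunE, opp_lfunE); ring.
Qed.

Lemma ext_jacobi p q r :
  ext_bracket p (ext_bracket q r) + ext_bracket q (ext_bracket r p)
  + ext_bracket r (ext_bracket p q) = 0.
Proof.
move: p q r => [[x u] alpha] [[y v] beta] [[z t] gamma].
congr (_, _, _) => /=; first exact: lie_jacobi.
  have <- := ext_lam_closed E x y z.
  rewrite /ce_d2 /trivial_action subrr add0r sub0r.
  rewrite (lieC z x) linearNr (ext_lam_skew E x) (ext_lam_skew E y).
  rewrite (ext_lam_skew E z) opprK.
  by rewrite addrAC [- _ - _]addrC addrAC.
have := ext_mu_closed E x y z.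
rewrite /ce_d2 /e_phi !(ext_phi E) !coad_lie.
have -> : mu (lie x z) y = - mu (lie z x) y by rewrite (lieC x z) linearNl.
rewrite (ext_mu_skew E x z) (coadN y (mu z x)) opprK.
rewrite !coadD !(coadN _ (_ + _)) !coadD.
rewrite (ext_mu_skew E x (lie _ _)) (ext_mu_skew E y (lie _ _)) (ext_mu_skew E z (lie _ _)).
exact: ext_jacobi_aux.
Qed.

HB.instance Definition _ :=
  isLieAlgebra.Build F (lie_ext charF0 E)
    ext_linearl ext_linearr ext_alternating ext_jacobi.

End Extension.

(* Main.v *)
Require Import Defs.
From mathcomp Require Import all_boot all_order all_algebra.
From HB Require Import structures.
From mathcomp Require Import ring.

(** On [h * a * h^*], consider the symmetric bilinear form
      [B ((x, u), alpha) ((y, v), beta)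
         = Ba (u - L x) (v - L y) + alpha y + beta x],
    that is, the sum of [Ba] and of the evaluation pairing of [h] with [h^*],
    pulled back along the linear automorphism
    [((x, u), alpha) |-> ((x, u - L x), alpha)].  It is non-degenerate because
    [Ba] and the evaluation pairing are ([ext_form_nondegenerate]).

    The pullback is what turns [lam] into [lamphi]: after the shear, the middle
    component of the bracket of [x] and [y] is [lam x y - L [x, y]], which is
    [lamphi x y] by hypothesis (i), and [phi] represents [lamphi] through [Ba].
    When [B [p, q] r + B q [p, r]] is expanded, the terms in which an element
    of [a] occurs cancel because [phi] represents the skew map [lamphi]; those
    in which an element of [h^*] occurs cancel by definition of the coadjoint
    action; on three elements [x], [y], [z] of [h]
    what remains is
      [mu x y z + mu x z y - Ba (lamphi x y) (L z) - Ba (lamphi x z) (L y)],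
    where the [mu] terms cancel because [mu] is skew and cyclic, and the other
    two because [lamphi] is skew and [Ba (lamphi x y) (L z)] is cyclic, which
    is hypothesis (ii) ([ext_form_invariant]). *)

Set Implicit Arguments.
Unset Strict Implicit.
Unset Printing Implicit Defensive.

Import GRing.Theory.
Local Open Scope ring_scope.

Lemma symmetric_formC (F : fieldType) (V : vectType F) (B : {symmetric V}) u v :
  B u v = B v u.
Proof. by rewrite (@hermitian_subproof _ _ _ _ B) expr0 mul1r. Qed.

Lemma nondegenerateP (F : fieldType) (V : vectType F) (B : {symmetric V}) :
  reflect (forall u, (forall v, B u v = 0) -> u = 0) (nondegenerate B).
Proof.
apply: (iffP eqP) => [rad0 u Bu0 | B_nondeg].
  by apply/eqP; rewrite -memv0 -rad0; apply/mem_orthovP => v _; apply: Bu0.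
apply/eqP; rewrite -subv0; apply/subvP => u /mem_orthovP Bu0.
by rewrite memv0; apply/eqP/B_nondeg => v; apply: Bu0; rewrite memvf.
Qed.

(** Linear forms separate the points of a finite-dimensional space. *)
Lemma linear_forms_separate (F : fieldType) (V : vectType F) (x : V) :
  (forall f : 'Hom(V, F^o), f x = 0) -> x = 0.
Proof.
move=> fx0; rewrite (coord_vbasis (memvf x)) big1 // => i _.
have := fx0 (linfun (coord (vbasis fullv) i : V -> F^o)).
by rewrite lfunE /= => ->; rewrite scale0r.
Qed.

Section ExtensionForm.
Variables (F : fieldType) (h a : vectType F).
Variables (Ba : {symmetric a}) (L : 'Hom(h, a)).

(** The sum of [Ba] and of the evaluation pairing between [h] and its dual,
    pulled back along the shear that subtracts [L x] from the [a]-component. *)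
Definition ext_form (p q : h * a * 'Hom(h, F^o)) : F :=
  let: (x, u, alpha) := p in let: (y, v, beta) := q in
  Ba (u - L x) (v - L y) + (alpha y : F) + (beta x : F).

Lemma ext_formC p q : ext_form p q = ext_form q p.
Proof.
move: p q => [[x u] alpha] [[y v] beta] /=.
by rewrite symmetric_formC addrAC.
Qed.

Lemma ext_form_linearr p : linear_for *%R (ext_form p).
Proof.
move: p => [[x u] alpha] c [[y v] beta] [[y' v'] beta'] /=.
have -> : c *: v + v' - L (c *: y + y') = c *: (v - L y) + (v' - L y').
  by rewrite linearP scalerBr opprD addrACA.
rewrite linearPr linearP add_lfunE scale_lfunE /=.
(* In the regular module [F^o], scaling is multiplication. *)
rewrite -![(_ : F) *: (_ : F^o)]/(_ * _).
by ring.
Qed.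

Lemma ext_form_linearl q : linear_for *%R (ext_form^~ q).
Proof.
by move=> c p p'; rewrite ext_formC ext_form_linearr !(ext_formC q).
Qed.

HB.instance Definition _ :=
  bilinear_isBilinear.Build F (h * a * 'Hom(h, F^o))%type
    (h * a * 'Hom(h, F^o))%type F *%R (idfun \; *%R) ext_form
    (ext_form_linearl, ext_form_linearr).

Lemma ext_form_hermitian p q :
  ext_form p q = (-1) ^+ false * idfun (ext_form q p).
Proof. by rewrite expr0 mul1r /= ext_formC. Qed.

HB.instance Definition _ :=
  isHermitianSesquilinear.Build F (h * a * 'Hom(h, F^o))%type false idfun
    ext_form ext_form_hermitian.

Lemma ext_form_nondegenerate : nondegenerate Ba -> nondegenerate ext_form.
Proof.
move=> /nondegenerateP Ba_nondeg; apply/nondegenerateP => -[[x u] alpha] B0.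
have x0 : x = 0.
  apply: linear_forms_separate => beta; have := B0 (0, 0, beta).
  by rewrite /= (linear0 L) (linear0 alpha) subr0 linear0r !add0r.
have u0 : u = 0.
  apply: Ba_nondeg => v; have := B0 (0, v, 0).
  by rewrite /= x0 !(linear0 L) (linear0 alpha) !subr0 zero_lfunE !addr0.
have alpha0 : alpha = 0.
  apply/lfunP => y; have := B0 (y, 0, 0).
  by rewrite /= x0 u0 (linear0 L) subr0 linear0l !zero_lfunE add0r addr0.
by rewrite x0 u0 alpha0.
Qed.

End ExtensionForm.

Lemma ext_form_invariant (F : fieldType) (h : lieAlgType F) (a : vectType F)
    (lam lamphi : {bilinear h -> h -> a})
    (mu : {bilinear h -> h -> 'Hom(h, F^o)})
    (phi : 'Hom(h, 'Hom(a, 'Hom(h, F^o)))) (Ba : {symmetric a})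
    (L : 'Hom(h, a)) :
  skew_symmetric_map lam -> skew_symmetric_map mu ->
  (forall x y z : h, mu x y z = mu y z x) ->
  (forall (x y : h) (u : a), phi x u y = - Ba (lamphi x y) u) ->
  (forall x y : h, lamphi x y = lam x y - L (lie x y)) ->
  (forall x y z : h, Ba (lamphi y z) (L x) = Ba (lamphi x y) (L z)) ->
  forall p q r,
    ext_form Ba L (ext_bracket lam mu phi p q) r
    = - ext_form Ba L q (ext_bracket lam mu phi p r).
Proof.
move=> lam_skew mu_skew mu_cyclic phiE lamphiE Lcyclic.
have lamphi_skew x y : lamphi x y = - lamphi y x.
  by rewrite !lamphiE lam_skew lieC linearN opprK opprB addrC.
move=> [[x u] alpha] [[y v] beta] [[z w] gamma] /=.
rewrite -!lamphiE !(add_lfunE, coadE, opp_lfunE) !phiE.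
rewrite !linearBr !linearBl.
(* The identities that [ring] cannot see: skewness and cyclicity of [mu] and
   [lamphi], and skewness of the bracket of [h]. *)
have muE : mu x z y = - mu x y z by rewrite mu_cyclic mu_skew opp_lfunE -mu_cyclic.
have LE : Ba (lamphi x z) (L y) = - Ba (lamphi x y) (L z).
  by rewrite (lamphi_skew x z) linearNl /= (Lcyclic y z x) (Lcyclic x y z).
have alphaE : alpha (lie z y) = - alpha (lie y z) by rewrite lieC linearN.
rewrite muE alphaE (lamphi_skew z y) linearNl /=.
rewrite (symmetric_formC Ba v) (symmetric_formC Ba (L y)) LE.
by ring.
Qed.

Theorem proposition2p4 (F : fieldType) (charF0 : [pchar F] =i pred0)
    (h : lieAlgType F) (a : vectType F)
    (lam : {bilinear h -> h -> a}) (mu : {bilinear h -> h -> 'Hom(h, F^o)})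
    (phi : 'Hom(h, 'Hom(a, 'Hom(h, F^o))))
    (E : extension_data lam mu phi)
    (mu_cyclic : forall x y z : h, mu x y z = mu y z x)
    (Ba : {symmetric a}) (Ba_nondeg : nondegenerate Ba)
    (lamphi : {bilinear h -> h -> a})
    (lamphiE : forall (x y : h) (u : a), phi x u y = - Ba (lamphi x y) u) :
  (exists L : 'Hom(h, a),
     (forall x y : h,
        lamphi x y = lam x y + ce_d1 (trivial_action a) L x y) /\
     (forall x y z : h, Ba (lamphi y z) (L x) = Ba (lamphi x y) (L z))) ->
  admits_invariant_metric (lie_ext charF0 E).
Proof.
move=> [L [lamphi_d1 Lcyclic]].
exists (ext_form Ba L : {symmetric (h * a * 'Hom(h, F^o))%type}).
split; first exact: ext_form_nondegenerate.
apply: (ext_form_invariant (ext_lam_skew E) (ext_mu_skew E) mu_cyclic lamphiE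
  _ Lcyclic) => x y.
by rewrite lamphi_d1 /ce_d1 /trivial_action subrr sub0r.
Qed.
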